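(* For every positive integer $r$ we have $$R_{\mathrm{list}}(K_{1,r},2)=R(K_{1,r},2)=\begin{cases}2r-1 & \text{if } r \text{ is even},\\ 2r & \text{if } r \text{ is odd}.\end{cases}$$
   Context: $K_n$ is the complete graph on $n$ vertices and $K_{1,r}$ is the star with $r$ edges. For a graph $G$ and a positive integer $k$, the ordinary Ramsey number $R(G,k)$ is the smallest $n$ such that every colouring of $E(K_n)$ with the colours $\{1,\dots,k\}$ contains a monochromatic copy of $G$. Given an assignment $L$ of a set $L_e\subseteq\mathbb{N}$ to each edge $e$ of $K_n$, an $L$-colouring is a function $c:E(K_n)\to\mathbb{N}$ with $c(e)\in L_e$ for all $e$. The list Ramsey number $R_{\mathrm{list}}(G,k)$ is the smallest $n$ for which there exists an assignment $L$ of lists with $|L_e|=k$ for every $e\in E(K_n)$ such that every $L$-colouring of $E(K_n)$ contains a monochromatic copy of $G$ (a not necessarily induced subgraph isomorphic to $G$ all of whose edges have the same colour). *)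

(* Defs.v *)
From mathcomp Require Import all_boot finmap.

Set Implicit Arguments.
Unset Strict Implicit.
Unset Printing Implicit Defensive.

Record sgraph := SGraph {
  vertex :> finType;
  adj : rel vertex;
  adj_sym : symmetric adj;
  adj_irr : irreflexive adj }.

Arguments adj : clear implicits.

Lemma complete_sym n : symmetric [rel x y : 'I_n | x != y].
Proof. by move=> x y /=; rewrite eq_sym. Qed.

Lemma complete_irr n : irreflexive [rel x y : 'I_n | x != y].
Proof. by move=> x /=; rewrite eqxx. Qed.

Definition complete (n : nat) : sgraph :=
  SGraph (@complete_sym n) (@complete_irr n).

Lemma star_sym r : symmetric [rel x y : option 'I_r | isSome x (+) isSome y].
Proof. by move=> x y /=; rewrite addbC. Qed.

Lemma star_irr r : irreflexive [rel x y : option 'I_r | isSome x (+) isSome y].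
Proof. by move=> x /=; rewrite addbb. Qed.

(* The centre of K_{1,r} is None and its leaves are the Some i. *)
Definition star (r : nat) : sgraph := SGraph (@star_sym r) (@star_irr r).

Definition is_edge (G : sgraph) (e : {set G}) : bool :=
  [exists x : G, exists y : G, adj G x y && (e == [set x; y])].

Definition edge (G : sgraph) := {e : {set G} | is_edge e}.

Definition mono_copy (G H : sgraph) (c : edge H -> nat) : Prop :=
  exists (f : G -> H) (a : nat),
    injective f /\
    forall x y : G, adj G x y ->
      exists e : edge H, val e = [set f x; f y] /\ c e = a.

Arguments mono_copy : clear implicits.

Definition arrows (G : sgraph) (k n : nat) : Prop :=
  forall c : edge (complete n) -> nat,
    (forall e, 1 <= c e <= k) -> mono_copy G (complete n) c.

Definition list_arrows (G : sgraph) (k n : nat) : Prop :=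
  exists L : edge (complete n) -> {fset nat},
    (forall e, #|` L e| = k) /\
    forall c : edge (complete n) -> nat,
      (forall e, c e \in L e) -> mono_copy G (complete n) c.

Definition is_least (P : nat -> Prop) (n : nat) : Prop :=
  P n /\ forall m, P m -> n <= m.

(* "R(G, k) = n" and "R_list(G, k) = n" are stated as relations, so that no
   value has to be assigned to the minimum of an empty set. *)
Definition ramsey_number (G : sgraph) (k n : nat) : Prop :=
  is_least (arrows G k) n.

Definition list_ramsey_number (G : sgraph) (k n : nat) : Prop :=
  is_least (list_arrows G k) n.

(* Main.v *)
Require Import Defs.
From mathcomp Require Import all_boot finmap zify.
From Stdlib Require Import ClassicalEpsilon.

Set Implicit Arguments.
Unset Strict Implicit.
Unset Printing Implicit Defensive.

(** The list and the ordinary Ramsey number of a star agree because the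
    extremal 2-colourings of K_n can be chosen so regular that they yield
    colourings from arbitrary lists of size two.  That the list Ramsey number is
    at most the ordinary one is seen by taking all lists equal to {1, 2}.

    Upper bound.  If no vertex of a 2-coloured K_n has r edges of one colour,
    then n - 1 <= 2 (r - 1), which settles n = 2r.  For n = 2r - 1 every vertex
    must have exactly r - 1 edges of colour 1, and for even r the degree sum
    (2r - 1)(r - 1) of that colour class is odd, against [handshake].

    Lower bound.  Put m = r - 1.  It is enough to sort the edges at each vertex
    into at most m classes of size at most two, and to colour from the lists so
    that the two edges of a class always differ: a colour then occurs at most m
    times at each vertex.  Joining the two edges of each class gives a conflict
    graph of maximum degree two on the edges of K_n.  If its cycles are all even
    it can be coloured from any lists of size two, since paths and even cycles
    are 2-choosable.

    The conflict graph is written down once for the complete graph on all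
    natural numbers and then restricted.  The positive integers are grouped into
    the pairs {1, 2}, {3, 4}, {5, 6} and so on.  The four edges between two
    pairs form a 4-cycle.  The six edges that 0 and the pairs {4k+1, 4k+2} and
    {4k+3, 4k+4} span inside the two triangles at 0 form a closed walk of length
    six, through the vertices
    0, 4k+1, 4k+2, 0, 4k+3, 4k+4, 0.
    The conflicts are between consecutive edges of these walks, so that all
    cycles have length four or six.  In the complete graph on 1, ..., 2m each
    vertex meets at most m classes, and so it does in the complete graph on
    0, ..., 2m when m is even, that is, when r is odd ([class_lt]).

    To avoid paths and cycles as objects, the conflict graph is given by the
    successor map [next] along the walks together with a 2-colouring [side] of
    the edges that alternates along it. *)

(** * Colouring from lists of size two *)

(** Follow the iterates of [f] from [e] until they meet [D], and alternate
    backwards from the label [d] found there; when they never meet [D], the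
    given alternating function [s] is already a solution. *)
Lemma alternating_labels (E : Type) (f : E -> E) (D : pred E) (d s : E -> bool) :
    (forall e, ~~ D e -> s (f e) = ~~ s e) ->
  exists b : E -> bool, forall e, b e = if D e then d e else ~~ b (f e).
Proof.
move=> flip; pose hits e := exists k, D (iter k f e).
pose b e := if excluded_middle_informative (hits e) is left h
            then d (iter (ex_minn h) f e) (+) odd (ex_minn h) else s e.
have bE e k : D (iter k f e) -> (forall j, j < k -> ~~ D (iter j f e)) ->
    b e = d (iter k f e) (+) odd k.
  rewrite /b; case: excluded_middle_informative => [h | nh] Dk lt_k; last first.
    by case: nh; exists k.
  case: ex_minnP => m Dm min_m; suff ->: m = k by [].
  apply/eqP; rewrite eqn_leq min_m //= leqNgt.
  by apply/negP => /lt_k; rewrite Dm.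
have bN e : ~ hits e -> b e = s e.
  by rewrite /b; case: excluded_middle_informative.
exists b => e; move: (b) bE bN => {}b bE bN.
case: ifPn => [De | nDe]; first by rewrite (bE e 0) //= addbF.
case: (excluded_middle_informative (hits (f e))) => [h | nh]; last first.
  rewrite !bN ?flip ?negbK // => -[[|k]]; first by rewrite /= (negPf nDe).
  by rewrite iterSr => Dk; apply: nh; exists k.
case: (ex_minnP h) => k Dk min_k.
have lt_k j : j < k -> ~~ D (iter j f (f e)).
  by move=> ltjk; apply/negP => /min_k; rewrite leqNgt ltjk.
rewrite (bE (f e) k) // (bE e k.+1) ?iterSr /= ?addbN //.
by case=> [|j] //; rewrite ltnS iterSr; apply: lt_k.
Qed.

Open Scope fset_scope.

(** Outgoing degree one and an alternating [s] make the conflict graph of [f]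
    bipartite with at most one cycle in each component.  Where the lists of [e]
    and [f e] differ, [e] can take a colour that [f e] cannot have, whatever
    [f e] becomes.  Where they agree, [e] takes the colour of the common list
    that [f e] does not take.  The second rule is recursive along [f], which is
    what [alternating_labels] resolves; on a cycle with constant lists it
    amounts to the proper 2-colouring [s]. *)
Lemma list_colouring (E : Type) (T : choiceType) (t0 : T) (f : E -> E) (ok : pred E)
    (s : E -> bool) (L : E -> {fset T}) :
    (forall e, ok e -> s (f e) = ~~ s e) -> (forall e, #|` L e| = 2) ->
  exists c : E -> T, (forall e, c e \in L e) /\
                     (forall e, ok e -> c e != c (f e)).
Proof.
move=> flip L2.
(* The default t0 is never reached: the lists have two elements and the index
   is a boolean read as 0 or 1. *)
pose p (A : {fset T}) (b : bool) := nth t0 A b.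
have p_in e b : p (L e) b \in L e.
  by apply: mem_nth; rewrite [size _]L2; case: b.
have p_neq e b : p (L e) b != p (L e) (~~ b).
  by rewrite nth_uniq ?fset_uniq // ?[size _]L2; case: b.
pose D := [pred e | ~~ ok e || (L e != L (f e))].
pose d e := p (L e) false \in L (f e).
have flipD e : ~~ D e -> s (f e) = ~~ s e.
  by rewrite /= negb_or negbK => /andP[/flip].
have [b bE] := alternating_labels d flipD.
exists (fun e => p (L e) (b e)); split=> // e ok_e.
have [eqL | neqL] := eqVneq (L e) (L (f e)).
  by rewrite bE /= ok_e eqL eqxx /= -eqL eq_sym p_neq.
suff: p (L e) (b e) \notin L (f e) by apply: contraNneq => ->.
rewrite bE /= ok_e neqL /= /d.
case in0: (p (L e) false \in L (f e)); last by rewrite in0.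
apply/negP => in1.
case/negP: neqL; rewrite eqEfcard !L2 leqnn andbT.
apply/fsubsetP => t /(nthP t0)[[|[|k]] lt_k <-] //.
by rewrite [size _]L2 in lt_k.
Qed.

Close Scope fset_scope.

(** * The conflict graph on the edges of the complete graph on nat *)

(** The other element of the pair {2i+1, 2i+2}, for positive arguments. *)
Definition sib x := if odd x then x.+1 else x.-1.

(** Edges are pairs (x, y) with x < y.  The branches are, in order: the edges at
    0, which belong to the walks 0, 4k+1, 4k+2, 0, 4k+3, 4k+4, 0; the edges
    inside a pair, which belong to the same walks; and the 4-cycle between two
    pairs, which is traversed by moving alternately at each end. *)
Definition next (e : nat * nat) : nat * nat :=
  let: (x, y) := e in
  if x == 0 then
    if odd y then (y, y.+1) else if y %% 4 == 2 then (0, y.+1) else (0, y - 3)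
  else if odd x && (y == x.+1) then (0, y)
  else if odd x == odd y then (x, sib y) else (sib x, y).

(** The parity of the position of an edge on its closed walk. *)
Definition side (e : nat * nat) : bool :=
  let: (x, y) := e in
  if x == 0 then odd y.-1./2
  else if odd x && (y == x.+1) then ~~ odd x./2
  else odd x (+) odd y.

Lemma side_next e : e.1 < e.2 -> side (next e) = ~~ side e.
Proof.
case: e => x y /= ltxy; rewrite /next /side /sib.
by repeat case: ifP; try lia; move=> *; rewrite eqxx; lia.
Qed.

Definition ends x y := (minn x y, maxn x y).

(** The class of the edge from v to w among the edges at v.  For v > 0 the
    classes come from the pairs, 0 being put with the sibling of v.  At 0 they
    are {4k+2, 4k+3}, with number 2k, and {4k+1, 4k+4}, with number 2k+1. *)
Definition class v w :=
  if v == 0 then if w %% 4 == 1 then w./2.+1 else w./2.-1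
  else if w == 0 then v.-1./2 else w.-1./2.

Ltac decide_ifs :=
  repeat first [rewrite ifT; last by lia | rewrite ifF; last by lia].
Ltac solve_next := decide_ifs; congr pair; lia.

(** A class consists of the edges by which one closed walk enters and leaves v
    in one visit; which of the two edges comes first depends on parities. *)
Lemma class_next (v w w' : nat) : v != w -> v != w' -> w != w' ->
  class v w = class v w' ->
  next (ends v w) = ends v w' \/ next (ends v w') = ends v w.
Proof.
move=> vw vw' ww'.
wlog ltww' : w w' vw vw' ww' / w < w'.
  move=> H; case: (ltngtP w w') ww' => // [lt | gt] ? clE.
    by apply: H => //; lia.
  by rewrite or_comm; apply: H => //; lia.
rewrite /class /ends /next /sib.
case: (eqVneq v 0) vw vw' => [-> | v0] vw vw' clE.
  have [w2 | w1] : w %% 4 = 2 /\ w' = w.+1 \/ w %% 4 = 1 /\ w' = w + 3.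
  - have w_gt0 : 0 < w by lia.
    by move: clE; case: ifP; case: ifP => *; lia.
  - by left; solve_next.
  - by right; solve_next.
case: (eqVneq w 0) vw ww' ltww' clE => [-> | w0] vw ww' ltww' clE.
  rewrite ifF in clE; last by lia.
  by case: (boolP (odd v)) => ov; [left | right]; solve_next.
rewrite ifF in clE; last by lia.
have [ow w'E] : odd w /\ w' = w.+1 by lia.
case: (ltnP v w) => ltvw; case: (boolP (odd v)) => ov.
- by left; solve_next.
- by right; solve_next.
- by right; solve_next.
- by left; solve_next.
Qed.

(** The parity of m matters only at 0, whose classes fill up blocks of four. *)
Lemma class_lt m (v w : nat) : 0 < v \/ ~~ odd m ->
  v <= 2 * m -> w <= 2 * m -> v != w -> class v w < m.
Proof. by rewrite /class => v_m lev lew vw; repeat case: ifP => *; lia. Qed.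

(** * Stars and colour degrees *)

(** A total version of [c] on ordered pairs of vertices; the value 0 on the
    diagonal carries no information. *)
Definition colour n (c : edge (complete n) -> nat) (v w : 'I_n) : nat :=
  oapp c 0 (insub [set v; w]).

Lemma colourC n (c : edge (complete n) -> nat) v w : colour c v w = colour c w v.
Proof. by rewrite /colour setUC. Qed.

Lemma is_edge_pair n (v w : 'I_n) : v != w -> is_edge (G := complete n) [set v; w].
Proof.
by move=> vw; apply/existsP; exists v; apply/existsP; exists w; rewrite /= vw eqxx.
Qed.

Lemma edge_pair n (e : edge (complete n)) :
  exists v w : 'I_n, v < w /\ val e = [set v; w].
Proof.
case: e => /= A /existsP[v /existsP[w /= /andP[vw /eqP ->]]].
case: (ltngtP v w) => [lt | gt | /val_inj eq]; first by exists v, w.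
  by exists w, v; rewrite setUC.
by rewrite eq eqxx in vw.
Qed.

Lemma colourE n (c : edge (complete n) -> nat) (e : edge (complete n)) v w :
  val e = [set v; w] -> colour c v w = c e.
Proof. by move=> eE; rewrite /colour -eE valK. Qed.

Lemma pair_inj n (v w v' w' : 'I_n) : v < w -> v' < w' ->
  [set v; w] = [set v'; w'] -> v = v' /\ w = w'.
Proof.
move=> lt lt' eqS.
have := set21 v w; have := set22 v w; have := set21 v' w'; have := set22 v' w'.
rewrite -{1 2}eqS eqS !inE -!(inj_eq val_inj) /= => *.
by split; apply: val_inj => /=; lia.
Qed.

Lemma mono_starP r n (c : edge (complete n) -> nat) :
  mono_copy (star r) (complete n) c <->
  exists v a, r <= #|[set w | (w != v) && (colour c v w == a)]|.
Proof.
split=> [[f [a [f_inj fP]]] | [v [a le_r]]].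
  exists (f None), a; rewrite -[r in r <= _]card_ord.
  have fS_inj : injective (fun i : 'I_r => f (Some i)) by move=> i j /f_inj [].
  rewrite -(card_imset _ fS_inj) subset_leq_card //.
  apply/subsetP => _ /imsetP[i _ ->]; rewrite inE (inj_eq f_inj) /=.
  by have [e [/colourE -> ->]] := fP None (Some i) isT.
set A := [set _ | _] in le_r.
pose leaf (i : 'I_r) := enum_val (widen_ord le_r i).
have leafP i : leaf i \in A by apply: enum_valP.
have leaf_edge i : exists e : edge (complete n), val e = [set v; leaf i] /\ c e = a.
  have := leafP i; rewrite inE eq_sym => /andP[vl /eqP <-].
  exists (Sub _ (is_edge_pair vl)); split; first by rewrite SubK.
  by rewrite -(@colourE _ c _ v (leaf i)) // SubK.
exists (fun x => if x is Some i then leaf i else v), a; split.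
  have leaf_neq i : leaf i <> v.
    by move=> eqv; have := leafP i; rewrite inE eqv eqxx.
  move=> [i|] [j|] //= => [eq_ij | /leaf_neq // | /esym /leaf_neq //].
  move/enum_val_inj/(congr1 val): eq_ij => /= ij; by congr Some; apply: val_inj.
move=> [i|] [j|] //= _; first by rewrite setUC; apply: leaf_edge.
Qed.

(** * The lower bound *)

Lemma arrows_list G n : arrows G 2 n -> list_arrows G 2 n.
Proof.
move=> arr; exists (fun=> [fset 1; 2]%fset); split=> [e | c cP].
  by rewrite cardfs2.
by apply: arr => e; have := cP e; rewrite !inE => /orP[] /eqP ->.
Qed.

(** The vertices of K_k are placed on o, ..., o + k - 1, inside the range in
    which [class_lt] leaves m classes at each vertex.  In a star with m + 1
    leaves two edges then share a class, so they are consecutive for [next] and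
    receive different colours. *)
Lemma star_not_list_arrows m k o : 0 < o \/ ~~ odd m -> o + k <= (2 * m).+1 ->
  ~ list_arrows (star m.+1) 2 k.
Proof.
move=> om le_k [L [L2 colourable]].
pose key (v w : 'I_k) := ends (o + v) (o + w).
(* The list {0, 1} is a filler for the pairs that are not edges of K_k. *)
have [L' [L'2 L'E]] : exists L' : nat * nat -> {fset nat},
    (forall p, #|` L' p|%fset = 2) /\
    forall (v w : 'I_k) e, v < w -> val e = [set v; w] -> L' (key v w) = L e.
  exists (fun p => if (insub (p.1 - o), insub (p.2 - o)) is (Some v, Some w)
                   then oapp L [fset 0; 1]%fset
                          (insub [set (v : 'I_k); (w : 'I_k)])
                   else [fset 0; 1]%fset); split.
    move=> p; do 2![case: insubP => [? _ _|_]; last by rewrite cardfs2].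
    by case: insubP => [e _ _ | _] /=; rewrite ?cardfs2 ?L2.
  move=> v w e ltvw eE; rewrite /key /ends /=.
  rewrite (minn_idPl _) ?(maxn_idPr _) ?leq_add2l 1?ltnW // !addKn !valK.
  by rewrite -eE valK.
have [col [col_in col_next]] := @list_colouring _ _ 0 next
  [pred e | e.1 < e.2] side L' (fun e => @side_next e) L'2.
have [c cP] : exists c : edge (complete k) -> nat,
    forall e, c e \in L e /\
      forall v w : 'I_k, val e = [set v; w] -> c e = col (key v w).
  apply: (fin_all_exists (P := fun e a => a \in L e /\
    forall v w : 'I_k, val e = [set v; w] -> a = col (key v w))) => e.
  have [v [w [ltvw eE]]] := edge_pair e.
  exists (col (key v w)); rewrite -(L'E _ _ _ ltvw eE); split=> // v' w'.
  rewrite eE => eqS; wlog lt' : v' w' eqS / v' < w'.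
    move=> H; case: (ltngtP v' w') => [lt | gt | /val_inj eq]; first exact: H.
      by rewrite [key v' w']/key /ends minnC maxnC; apply: H; rewrite // eqS setUC.
    move: ltvw; have := set21 v w; have := set22 v w.
    by rewrite eqS eq !inE !orbb => /eqP -> /eqP ->; rewrite ltnn.
  by have [-> ->] := pair_inj ltvw lt' eqS.
have /mono_starP[v [a]] := colourable c (fun e => proj1 (cP e)).
rewrite leqNgt => /negP; apply.
have colour_key w : w != v -> colour c v w = col (key v w).
  rewrite eq_sym => vw; pose e : edge (complete k) := Sub _ (is_edge_pair vw).
  have eE : val e = [set v; w] by rewrite SubK.
  by rewrite (colourE c eE) (proj2 (cP e) _ _ eE).
set A := [set w | _]; pose cl (w : 'I_k) := class (o + v) (o + w).
rewrite cardE -(size_map cl) -(size_iota 0 m) ltnS uniq_leq_size //.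
  rewrite map_inj_in_uniq ?enum_uniq // => w w'; rewrite !mem_enum !inE.
  move=> /andP[wv /eqP wa] /andP[w'v /eqP w'a] clE; apply/eqP/negPn/negP => ww'.
  have {wa w'a} eq_col : col (key v w) = col (key v w').
    by rewrite -!colour_key // wa w'a.
  have lt_key u : u != v -> (key v u).1 < (key v u).2.
    by rewrite -(inj_eq val_inj) /= => uv; lia.
  have [||| next_w | next_w'] := class_next _ _ _ clE;
    rewrite ?eqn_add2l ?(inj_eq val_inj) // 1?eq_sym //.
  - by have /negP[] := col_next _ (lt_key _ wv); rewrite [next _]next_w eq_col.
  - by have /negP[] := col_next _ (lt_key _ w'v); rewrite [next _]next_w' eq_col.
move=> x /mapP[w]; rewrite mem_enum inE => /andP[wv _] ->.
rewrite mem_iota /= add0n; apply: class_lt.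
- by case: om; [left; lia | right].
- by have := ltn_ord v; lia.
- by have := ltn_ord w; lia.
- by rewrite eqn_add2l (inj_eq val_inj) eq_sym.
Qed.

(** * The upper bound *)

(** Each edge is counted once from its smaller and once from its larger end. *)
Lemma handshake n (e : rel 'I_n) : symmetric e -> irreflexive e ->
  ~~ odd (\sum_v #|[set w | e v w]|).
Proof.
move=> e_sym e_irr.
pose S := \sum_(v < n) \sum_(w < n) ((v < w) && e v w : nat).
suff -> : \sum_v #|[set w | e v w]| = S + S by rewrite addnn odd_double.
rewrite [X in S + X]exchange_big /= -big_split; apply: eq_bigr => v _ /=.
rewrite -big_split -sum1_card big_mkcond; apply: eq_bigr => w _ /=.
rewrite inE [e w v]e_sym.
by case: (ltngtP v w) => [||/val_inj <-]; rewrite ?e_irr //=; case: (e _ _).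
Qed.

Lemma arrows_star r : 0 < r ->
  arrows (star r) 2 (if odd r then 2 * r else 2 * r - 1).
Proof.
move=> r_gt0; move nE: (if odd r then _ else _) => n c c12.
pose D a (v : 'I_n) := [set w | (w != v) && (colour c v w == a)].
case: (boolP [exists v, (r <= #|D 1 v|) || (r <= #|D 2 v|)]) => [/existsP[v] | ].
  by case/orP => le_r; apply/mono_starP; exists v; [exists 1 | exists 2].
rewrite negb_exists => /forallP small; exfalso.
have deg v : #|D 1 v| + #|D 2 v| = n.-1.
  rewrite -[n in n.-1]card_ord -(cardsC1 v) -cardsUI.
  rewrite [D 1 v :&: _](_ : _ = set0) ?cards0 ?addn0.
    congr #|pred_of_set _|; apply/setP => w; rewrite !inE -andb_orr.
    case: eqVneq => //= wv; rewrite eq_sym in wv.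
    pose e : edge (complete n) := Sub _ (is_edge_pair wv).
    rewrite (@colourE _ c e) ?SubK //; have := c12 e; lia.
  by apply/setP => w; rewrite !inE; case: eqVneq => //= _; case: eqP => // ->.
have n_gt0 : 0 < n by rewrite -nE; case: ifP; lia.
have := small (Ordinal n_gt0); have := deg (Ordinal n_gt0).
case: ifP nE => r_odd nE; first by lia.
(* Every vertex has degree exactly r - 1 in the graph of colour 1, and both
   n = 2r - 1 and r - 1 are odd. *)
pose red := [rel v w | (w != v) && (colour c v w == 1)].
have red_sym : symmetric red by move=> v w; rewrite /= eq_sym colourC.
have red_irr : irreflexive red by move=> v; rewrite /= eqxx.
move=> _ _; have := handshake red_sym red_irr.
rewrite (eq_bigr (fun=> r.-1)) => [|v _].
  by rewrite sum_nat_const card_ord oddM -nE; lia.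
by rewrite -[LHS]/(#|D 1 v|); move: (small v) (deg v); lia.
Qed.

Theorem theorem2 (r : nat) (hr : 0 < r) :
  let N := if odd r then 2 * r else 2 * r - 1 in
  list_ramsey_number (star r) 2 N /\ ramsey_number (star r) 2 N.
Proof.
have lower k :
    list_arrows (star r) 2 k -> (if odd r then 2 * r else 2 * r - 1) <= k.
  case: r hr => // m _ arr; rewrite leqNgt; apply/negP => ltk; move: arr.
  have [m_odd | m_even] := boolP (odd m).
    apply: (@star_not_list_arrows m k 1); first by left.
    by move: ltk; rewrite /= m_odd /=; lia.
  apply: (@star_not_list_arrows m k 0); first by right.
  by move: ltk; rewrite /= m_even /=; lia.
have upper := arrows_star hr.
split; split; [exact: arrows_list | exact: lower | exact: upper |].
by move=> k /arrows_list; apply: lower.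
Qed.
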